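(* Let $F$ be a loop, $A$ an abelian group, $\theta\in C(F,A)$ a normalized cocycle, and $Q_\theta=Q(F,A,\theta)$. If the automorphism group $\mathrm{Aut}(Q_\theta)$ acts transitively on the set $$\{K\le Z(Q_\theta)\ :\ K\cong A,\ Q_\theta/K\simeq F\},$$ then $\theta$ is isotopy separable.
   Context: A loop is a set with a binary operation having a two-sided neutral element (written $1$) and such that for all $a,b$ the equations $ax=b$, $ya=b$ have unique solutions. The center $Z(Q)$ of a loop $Q$ is the set of $x\in Q$ with $xy=yx$, $(xy)z=x(yz)$, $(yx)z=y(xz)$, $(yz)x=y(zx)$ for all $y,z\in Q$. An isotopism from a loop $(L_1,\cdot)$ to a loop $(L_2,\ast)$ is a triple $(\alpha,\beta,\gamma)$ of bijections $L_1\to L_2$ with $\alpha(x)\ast\beta(y)=\gamma(x\cdot y)$ for all $x,y\in L_1$; if one exists, write $L_1\simeq L_2$ (isotopic). $\cong$ denotes isomorphism. $\mathrm{Atp}(F)$ is the group of autotopisms of $F$ (isotopisms from $F$ to $F$) under composition, and $\mathrm{Atp}(F,A)=\mathrm{Atp}(F)\times\mathrm{Aut}(A)$. $C(F,A)$ is the abelian group of (normalized) cocycles: maps $\theta:F\times F\to A$ with $\theta(1,x)=\theta(x,1)=0$ for all $x\in F$. For $\theta\in C(F,A)$, $Q(F,A,\theta)$ is the loop on $F\times A$ with multiplication $(x,a)(y,b)=(xy,a+b+\theta(x,y))$. For $\tau:F\to A$ with $\tau(1)=0$ let $\widehat\tau(x,y)=\tau(xy)-\tau(x)-\tau(y)$;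 the set of all such $\widehat\tau$ is the subgroup $B(F,A)\le C(F,A)$ of coboundaries. For $m:F\times F\to A$ let $N(m)(x,y)=m(x,y)-m(x,1)-m(1,y)+m(1,1)$. For $t=(\alpha,\beta,\gamma)\in\mathrm{Atp}(F)$, $h\in\mathrm{Aut}(A)$ and $\theta\in C(F,A)$, define ${}^{(t,h)}\theta=N\big((x,y)\mapsto h(\theta(\alpha^{-1}(x),\beta^{-1}(y)))\big)\in C(F,A)$. For $\theta,\mu\in C(F,A)$ write $\theta\sim\mu$ if $\mu={}^{(t,h)}\theta+b$ for some $(t,h)\in\mathrm{Atp}(F,A)$ and $b\in B(F,A)$. (If $\theta\sim\mu$ then $Q(F,A,\theta)\simeq Q(F,A,\mu)$.) A cocycle $\theta$ is isotopy separable if for every $\mu\in C(F,A)$, $Q(F,A,\theta)\simeq Q(F,A,\mu)$ implies $\theta\sim\mu$. *)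

(* Defs.v *)
From mathcomp Require Import all_boot all_order all_algebra.
From mathcomp Require Import boolp classical_sets.

Set Implicit Arguments.
Unset Strict Implicit.
Unset Printing Implicit Defensive.

Import GRing.Theory.

Local Open Scope classical_set_scope.

Declare Scope loop_scope.
Delimit Scope loop_scope with L.

Record loop := Loop {
  carrier :> Type;
  mul : carrier -> carrier -> carrier;
  one : carrier;
  mul1x : forall x, mul one x = x;
  mulx1 : forall x, mul x one = x;
  ldiv_uniq : forall a b, exists! x, mul a x = b;
  rdiv_uniq : forall a b, exists! y, mul y a = b
}.
Bind Scope loop_scope with carrier.
Arguments mul {l}.
Arguments one {l}.

Notation "x * y" := (mul x y) : loop_scope.
Notation "1" := one : loop_scope.

Local Open Scope loop_scope.

Definition isomorphism (L1 L2 : loop) (f : L1 -> L2) : Prop :=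
  bijective f /\ forall x y, f (x * y) = f x * f y.

Definition isomorphic (L1 L2 : loop) : Prop :=
  exists f : L1 -> L2, isomorphism f.

(* The inverse is stored so that alpha^-1, beta^-1 need no choice. *)
Record bijection (X Y : Type) := Bijection {
  bij_fun :> X -> Y;
  bij_inv : Y -> X;
  bij_funK : cancel bij_fun bij_inv;
  bij_invK : cancel bij_inv bij_fun
}.

Record isotopism (L1 L2 : loop) := Isotopism {
  iso_alpha : bijection L1 L2;
  iso_beta : bijection L1 L2;
  iso_gamma : bijection L1 L2;
  isotopism_law : forall x y, iso_alpha x * iso_beta y = iso_gamma (x * y)
}.

Definition isotopic (L1 L2 : loop) : Prop := inhabited (isotopism L1 L2).

Definition autotopism (F : loop) := isotopism F F.

Definition center (Q : loop) : set Q :=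
  [set x | forall y z : Q, [/\ x * y = y * x, (x * y) * z = x * (y * z),
                              (y * x) * z = y * (x * z)
                            & (y * z) * x = y * (z * x)]].

Record subloop (Q : loop) := Subloop {
  sub_set :> set Q;
  sub_one : sub_set 1;
  sub_mul : forall x y, sub_set x -> sub_set y -> sub_set (x * y);
  sub_ldiv : forall a x, sub_set a -> sub_set (a * x) -> sub_set x;
  sub_rdiv : forall a y, sub_set a -> sub_set (y * a) -> sub_set y
}.

Record central_subloop (Q : loop) := CentralSubloop {
  csub :> subloop Q;
  csub_central : csub `<=` @center Q
}.

Section SubloopLoop.
Variables (Q : loop) (K : subloop Q).

Definition subl_carrier := {x : Q | sub_set K x}.

Definition subl_one : subl_carrier := exist _ 1 (sub_one K).

Definition subl_mul (x y : subl_carrier) : subl_carrier :=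
  exist _ (sval x * sval y) (sub_mul (svalP x) (svalP y)).

Lemma subl_inj (x y : subl_carrier) : sval x = sval y -> x = y.
Proof.
case: x y => [x Kx] [y Ky] /= exy; subst y.
by rewrite (Prop_irrelevance Kx Ky).
Qed.

Lemma subl_mul1x x : subl_mul subl_one x = x.
Proof. by apply: subl_inj; rewrite /= mul1x. Qed.

Lemma subl_mulx1 x : subl_mul x subl_one = x.
Proof. by apply: subl_inj; rewrite /= mulx1. Qed.

Lemma subl_ldiv a b : exists! x, subl_mul a x = b.
Proof.
have [x [ax xU]] := ldiv_uniq (sval a) (sval b).
have Kx : sub_set K x by apply: (sub_ldiv (svalP a)); rewrite ax; exact: svalP.
exists (exist _ x Kx); split; first exact: subl_inj.
by move=> x' e; apply: subl_inj; apply: xU; rewrite -e.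
Qed.

Lemma subl_rdiv a b : exists! y, subl_mul y a = b.
Proof.
have [x [ax xU]] := rdiv_uniq (sval a) (sval b).
have Kx : sub_set K x by apply: (sub_rdiv (svalP a)); rewrite ax; exact: svalP.
exists (exist _ x Kx); split; first exact: subl_inj.
by move=> x' e; apply: subl_inj; apply: xU; rewrite -e.
Qed.

Definition subloop_loop : loop :=
  Loop subl_mul1x subl_mulx1 subl_ldiv subl_rdiv.

End SubloopLoop.

Section Quotient.
Variables (Q : loop) (K : central_subloop Q).

Definition coset (x : Q) : set Q := [set x * k | k in K].

Definition quot_carrier := {S : set Q | exists x, S = coset x}.

Definition quot_class (x : Q) : quot_carrier :=
  exist _ (coset x) (ex_intro _ x erefl).

(* For K central, (xK)(yK) = (xy)K also as a product of subsets, so cosets can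
   be multiplied without choosing representatives. *)
Definition set_mul (S T : set Q) : set Q :=
  [set s * t | s in S & t in T].

Lemma mul_coset x y k l :
  sub_set K k -> sub_set K l -> (x * k) * (y * l) = (x * y) * (k * l).
Proof.
move=> /csub_central Zk /csub_central Zl.
have [_ _ kA2 _] := Zk x (y * l).
have [_ _ _ lAk] := Zl y k.
have [_ _ _ lAxyk] := Zl (x * y) k.
have [_ _ _ kAxy] := Zk x y.
have [ky _ _ _] := Zk y y.
have [_ kyA _ _] := Zk y l.
rewrite kA2 -kyA ky lAk.
have [_ _ _ klA] := Zl x (y * k).
by rewrite -lAxyk kAxy klA lAk.
Qed.

Lemma set_mul_coset x y : set_mul (coset x) (coset y) = coset (x * y).
Proof.
apply/seteqP; split=> z.
  move=> [_ [k Kk <-] [_ [l Kl <-] <-]].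
  by exists (k * l); [exact: (sub_mul Kk Kl) | exact/esym/mul_coset].
move=> [k Kk <-]; exists (x * k); first by exists k.
exists (y * 1); first by exists 1 => //; exact: sub_one.
by rewrite (mul_coset x y Kk (sub_one K)) mulx1.
Qed.

Lemma quot_mul_subproof (S T : quot_carrier) :
  exists x, set_mul (sval S) (sval T) = coset x.
Proof.
have [[x ->] [y ->]] := (svalP S, svalP T).
by exists (x * y); exact: set_mul_coset.
Qed.

Definition quot_mul (S T : quot_carrier) : quot_carrier :=
  exist _ (set_mul (sval S) (sval T)) (quot_mul_subproof S T).

Lemma quot_inj (S T : quot_carrier) : sval S = sval T -> S = T.
Proof.
case: S T => [S pS] [T pT] /= eST; subst T.
by rewrite (Prop_irrelevance pS pT).
Qed.

Lemma quot_classP (S : quot_carrier) : exists x, S = quot_class x.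
Proof. by case: S => [S [x Sx]]; exists x; apply: quot_inj. Qed.

Lemma quot_mulE x y :
  quot_mul (quot_class x) (quot_class y) = quot_class (x * y).
Proof. by apply: quot_inj; rewrite /= set_mul_coset. Qed.

Lemma quot_class_eq x y :
  quot_class x = quot_class y <-> exists2 k, sub_set K k & y = x * k.
Proof.
split=> [/(congr1 sval) /= exy|[k Kk ->]].
  have : coset y y by exists 1; [exact: sub_one | rewrite mulx1].
  by rewrite -exy => -[k Kk <-]; exists k.
apply: quot_inj => /=; apply/seteqP; split=> z [l Kl <-].
  have [m [kml _]] := ldiv_uniq k l.
  have Km : sub_set K m by apply: (sub_ldiv Kk); rewrite kml.
  exists m => //; have [_ _ _ ->] := csub_central Km x k.
  by rewrite kml.
exists (k * l); first by apply: sub_mul.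
by have [_ _ _ ->] := csub_central Kl x k.
Qed.

Lemma quot_mul1x S : quot_mul (quot_class 1) S = S.
Proof. by have [x ->] := quot_classP S; rewrite quot_mulE mul1x. Qed.

Lemma quot_mulx1 S : quot_mul S (quot_class 1) = S.
Proof. by have [x ->] := quot_classP S; rewrite quot_mulE mulx1. Qed.

Lemma quot_ldiv S T : exists! X, quot_mul S X = T.
Proof.
have [[a ->] [b ->]] := (quot_classP S, quot_classP T).
have [x [ax _]] := ldiv_uniq a b.
exists (quot_class x); split=> [|X]; first by rewrite quot_mulE ax.
have [x' ->] := quot_classP X.
rewrite quot_mulE -ax => /esym/quot_class_eq[k Kk ax'].
apply/quot_class_eq; exists k => //.
have [_ _ _ Zk] := csub_central Kk a x.
have [u [_ uU]] := ldiv_uniq a (a * x').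
by rewrite -(uU x' erefl) -(uU (x * k)) // ax' Zk.
Qed.

Lemma quot_rdiv S T : exists! Y, quot_mul Y S = T.
Proof.
have [[a ->] [b ->]] := (quot_classP S, quot_classP T).
have [y [ya _]] := rdiv_uniq a b.
exists (quot_class y); split=> [|Y]; first by rewrite quot_mulE ya.
have [y' ->] := quot_classP Y.
rewrite quot_mulE -ya => /esym/quot_class_eq[k Kk ya'].
apply/quot_class_eq; exists k => //.
have [_ _ ZkA Zk] := csub_central Kk y a.
have [ka _ _ _] := csub_central Kk a a.
have [u [_ uU]] := rdiv_uniq a (y' * a).
by rewrite -(uU y' erefl) -(uU (y * k)) // ya' Zk ZkA ka.
Qed.

Definition quotient : loop :=
  Loop quot_mul1x quot_mulx1 quot_ldiv quot_rdiv.

End Quotient.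

Section ZmodLoop.
Variable A : zmodType.
Local Open Scope ring_scope.

Lemma zmod_ldiv (a b : A) : exists! x, a + x = b.
Proof.
by exists (b - a); split=> [|x <-]; [rewrite addrC subrK | rewrite addrC addKr].
Qed.

Lemma zmod_rdiv (a b : A) : exists! y, y + a = b.
Proof. by exists (b - a); split=> [|x <-]; rewrite ?subrK ?addrK. Qed.

Definition zmod_loop : loop := Loop (@add0r A) (@addr0 A) zmod_ldiv zmod_rdiv.

End ZmodLoop.

Record cocycle (F : loop) (A : zmodType) := Cocycle {
  cocycle_fun :> F -> F -> A;
  cocycle1x : forall x, cocycle_fun 1 x = 0%R;
  cocyclex1 : forall x, cocycle_fun x 1 = 0%R
}.

Section Extension.
Variables (F : loop) (A : zmodType) (theta : cocycle F A).

Definition ext_carrier := (F * A)%type.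

Definition ext_one : ext_carrier := (1, 0%R).

Definition ext_mul (u v : ext_carrier) : ext_carrier :=
  (u.1 * v.1, (u.2 + v.2 + theta u.1 v.1)%R).

Lemma ext_mul1x u : ext_mul ext_one u = u.
Proof. by case: u => x a; rewrite /ext_mul /= mul1x cocycle1x add0r addr0. Qed.

Lemma ext_mulx1 u : ext_mul u ext_one = u.
Proof. by case: u => x a; rewrite /ext_mul /= mulx1 cocyclex1 !addr0. Qed.

Lemma ext_ldiv u v : exists! w, ext_mul u w = v.
Proof.
case: u v => [x a] [y b]; have [z [xz zU]] := ldiv_uniq x y.
exists (z, (b - theta x z - a)%R); split.
  by rewrite /ext_mul /= xz [(a + _)%R]addrC !subrK.
case=> z' c [/zU <- <-]; congr pair.
by rewrite addrK addrC addKr.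
Qed.

Lemma ext_rdiv u v : exists! w, ext_mul w u = v.
Proof.
case: u v => [x a] [y b]; have [z [zx zU]] := rdiv_uniq x y.
exists (z, (b - theta z x - a)%R); split.
  by rewrite /ext_mul /= zx !subrK.
case=> z' c [/zU <- <-]; congr pair.
by rewrite !addrK.
Qed.

Definition extension : loop := Loop ext_mul1x ext_mulx1 ext_ldiv ext_rdiv.

End Extension.

Section Equivalence.
Variables (F : loop) (A : zmodType).
Local Open Scope ring_scope.

Definition normalize (m : F -> F -> A) (x y : F) : A :=
  m x y - m x 1%L - m 1%L y + m 1%L 1%L.

Lemma normalize1x m x : normalize m 1%L x = 0.
Proof. by rewrite /normalize addrAC subrK subrr. Qed.

Lemma normalizex1 m x : normalize m x 1%L = 0.
Proof. by rewrite /normalize subrr sub0r addNr. Qed.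

Definition normalized (m : F -> F -> A) : cocycle F A :=
  Cocycle (normalize1x m) (normalizex1 m).

Definition atp_act (t : autotopism F) (h : A -> A) (theta : cocycle F A) :
    cocycle F A :=
  normalized (fun x y =>
    h (theta (bij_inv (iso_alpha t) x) (bij_inv (iso_beta t) y))).

Definition coboundary : set (cocycle F A) :=
  [set b | exists tau : F -> A, tau 1%L = 0 /\
     forall x y, b x y = tau (x * y)%L - tau x - tau y].

Definition cocycle_equiv (theta mu : cocycle F A) : Prop :=
  exists (t : autotopism F) (h : {additive A -> A}) (b : cocycle F A),
    [/\ bijective h, coboundary b
      & forall x y, mu x y = atp_act t h theta x y + b x y].

Definition isotopy_separable (theta : cocycle F A) : Prop :=
  forall mu : cocycle F A,
    isotopic (extension theta) (extension mu) -> cocycle_equiv theta mu.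

End Equivalence.

(* Automorphisms act by direct image; K and L are compared as subsets of Q. *)
Definition aut_transitive (Q : loop) (X : set (central_subloop Q)) : Prop :=
  forall K L : central_subloop Q, X K -> X L ->
    exists f : Q -> Q, isomorphism f /\ f @` K = L :> set Q.

(* Main.v *)
Require Import Defs.
From HB Require Import structures.
From mathcomp Require Import all_boot all_order all_algebra.
From mathcomp Require Import boolp classical_sets.
Local Open Scope classical_set_scope.

(** The translations of [extension mu] by the central copy of [A] commute with
    multiplication on either side, and an isotopism [T : Q -> extension mu]
    pulls them back to maps [R] of [Q] with [R x * y = R (x * y) = x * R y],
    that is, to multiplications by central elements [R 1]. These form a central
    subloop of [Q] isomorphic to [A], with quotient isotopic to [F]. The
    standard copy of [A] in [extension theta] is the one obtained from the
    identity isotopism, so by transitivity an automorphism carries it to the one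
    obtained from [T]. After composing with this automorphism, [T] maps fibres
    over [F] to fibres, hence induces an autotopism of [F] and an automorphism
    of [A]; comparing the [A]-components of the isotopism law and normalizing
    yields the equivalence of the cocycles. *)

Set Implicit Arguments.
Unset Strict Implicit.
Unset Printing Implicit Defensive.
Import GRing.Theory.
Local Open Scope loop_scope.

(** * Cancellation, bijections and composition of isotopisms *)

Lemma mul_injl (Q : loop) (a x y : Q) : a * x = a * y -> x = y.
Proof.
by move=> e; have [z [_ zU]] := ldiv_uniq a (a * y); rewrite -(zU x e) (zU y).
Qed.

Lemma bijection_of_inj_surj (X Y : Type) (f : X -> Y) :
  injective f -> (forall y, exists x, f x = y) ->
  exists p : bijection X Y, p =1 f.
Proof.
move=> f_inj /choice[g gK]; have fK : cancel f g by move=> x; apply: f_inj.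
by exists (Bijection fK gK).
Qed.

Definition bijection_id (X : Type) : bijection X X :=
  @Bijection X X id id (fun=> erefl) (fun=> erefl).

Definition bijection_comp (X Y Z : Type) (p : bijection Y Z)
    (q : bijection X Y) : bijection X Z :=
  Bijection (can_comp (bij_funK p) (bij_funK q))
            (can_comp (bij_invK q) (bij_invK p)).

Definition isotopism_id (Q : loop) : isotopism Q Q :=
  @Isotopism Q Q (bijection_id Q) (bijection_id Q) (bijection_id Q)
    (fun _ _ => erefl).

Lemma isotopism_comp_law (P Q R : loop) (T : isotopism Q R)
    (f : bijection P Q) (fM : forall x y, f (x * y) = f x * f y) x y :
  bijection_comp (iso_alpha T) f x * bijection_comp (iso_beta T) f y =
  bijection_comp (iso_gamma T) f (x * y).
Proof. by rewrite /= isotopism_law fM. Qed.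

Definition isotopism_comp (P Q R : loop) (T : isotopism Q R)
    (f : bijection P Q) (fM : forall x y, f (x * y) = f x * f y) :
  isotopism P R := Isotopism (isotopism_comp_law T fM).

(** * The central copy of [A] pulled back along an isotopism *)

Section PulledBackKernel.
Variables (F : loop) (A : zmodType) (mu : cocycle F A).
Variables (Q : loop) (T : isotopism Q (extension mu)).
Local Notation E := (extension mu).

(** This is multiplication by the central element [(1, d)]; its orbits are the fibres over [F]. *)
Definition shift (u : E) (d : A) : E := (u.1, (u.2 + d)%R).

Lemma shiftMl u v d : shift u d * v = shift (u * v) d.
Proof. by congr pair; rewrite /= -!addrA [(d + _)%R]addrC !addrA. Qed.

Lemma shiftMr u v d : u * shift v d = shift (u * v) d.
Proof. by congr pair; rewrite /= -!addrA [(d + _)%R]addrC. Qed.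

Lemma shiftD u d e : shift (shift u d) e = shift u (d + e)%R.
Proof. by rewrite /shift /= addrA. Qed.

Lemma shift0 u : shift u 0%R = u.
Proof. by rewrite /shift addr0 -surjective_pairing. Qed.

Lemma shift_inj u : injective (shift u).
Proof. by move=> d e [/addrI]. Qed.

Lemma eq_fst_shift (u v : E) : u.1 = v.1 -> v = shift u (v.2 - u.2)%R.
Proof. by case: u v => [x a] [y b] /= ->; rewrite /shift /= addrC subrK. Qed.

(** Conjugation uses the third component of [T]; by [alpha_pullback] and [beta_pullback], the other
    two give the same map. *)
Definition pullback_translation d (x : Q) : Q :=
  bij_inv (iso_gamma T) (shift (iso_gamma T x) d).

Local Notation R := pullback_translation.

Lemma gamma_pullback d x : iso_gamma T (R d x) = shift (iso_gamma T x) d.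
Proof. exact: bij_invK. Qed.

(** Shifting the left factor of a product in [E] shifts the product, which the isotopism law reads
    through [iso_gamma T]. The case [y = 1] identifies the conjugate by [iso_alpha T] with [R d]. *)
Lemma alpha_shift_inv d x y :
  bij_inv (iso_alpha T) (shift (iso_alpha T x) d) * y = R d (x * y).
Proof.
apply: (can_inj (bij_funK (iso_gamma T))).
by rewrite gamma_pullback -!isotopism_law bij_invK shiftMl.
Qed.

Lemma beta_shift_inv d x y :
  x * bij_inv (iso_beta T) (shift (iso_beta T y) d) = R d (x * y).
Proof.
apply: (can_inj (bij_funK (iso_gamma T))).
by rewrite gamma_pullback -!isotopism_law bij_invK shiftMr.
Qed.

Lemma alpha_pullback d x : iso_alpha T (R d x) = shift (iso_alpha T x) d.
Proof. by rewrite -{1}(mulx1 x) -alpha_shift_inv mulx1 bij_invK. Qed.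

Lemma beta_pullback d x : iso_beta T (R d x) = shift (iso_beta T x) d.
Proof. by rewrite -{1}(mul1x x) -beta_shift_inv mul1x bij_invK. Qed.

Lemma pullbackMl d x y : R d x * y = R d (x * y).
Proof. by rewrite -alpha_shift_inv -alpha_pullback bij_funK. Qed.

Lemma pullbackMr d x y : x * R d y = R d (x * y).
Proof. by rewrite -beta_shift_inv -beta_pullback bij_funK. Qed.

Lemma pullbackD d e x : R (d + e)%R x = R e (R d x).
Proof.
apply: (can_inj (bij_funK (iso_gamma T))).
by rewrite !gamma_pullback shiftD.
Qed.

Lemma pullback0 x : R 0%R x = x.
Proof. by rewrite /R shift0 bij_funK. Qed.

Lemma pullback_inj x : injective (R^~ x).
Proof.
by move=> d e /(congr1 (iso_gamma T)); rewrite !gamma_pullback => /shift_inj.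
Qed.

Definition pullback_set : set Q := range (R^~ 1).

Lemma mul_pullback1 x d : x * R d 1 = R d x.
Proof. by rewrite pullbackMr mulx1. Qed.

(** [R d] moves freely out of either factor, so both sides of each identity become [R d] of the same
    product. *)
Lemma pullback_central : pullback_set `<=` @center Q.
Proof.
by move=> _ [d _ <-] y z; split; rewrite !(pullbackMl, pullbackMr, mul1x, mulx1).
Qed.

Lemma pullback_set1 : pullback_set 1.
Proof. by exists 0%R => //; rewrite pullback0. Qed.

Lemma pullback_setM x y :
  pullback_set x -> pullback_set y -> pullback_set (x * y).
Proof.
move=> [d _ <-] [e _ <-]; exists (d + e)%R => //.
by rewrite pullbackD mul_pullback1.
Qed.

Lemma pullback_set_ldiv a x :
  pullback_set a -> pullback_set (a * x) -> pullback_set x.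
Proof.
move=> [d _ <-] [e _ ex]; exists (- d + e)%R => //.
by apply: (@mul_injl _ (R d 1)); rewrite mul_pullback1 -pullbackD addrA subrr add0r.
Qed.

Lemma pullback_set_rdiv a y :
  pullback_set a -> pullback_set (y * a) -> pullback_set y.
Proof.
move=> Ka; have [<- _ _ _] := pullback_central Ka y y.
exact: pullback_set_ldiv.
Qed.

Definition pullback_subloop : central_subloop Q :=
  @CentralSubloop Q
    (Subloop pullback_set1 pullback_setM pullback_set_ldiv pullback_set_rdiv)
    pullback_central.

Lemma pullback_isomorphic :
  isomorphic (subloop_loop pullback_subloop) (zmod_loop A).
Proof.
have Rset d : pullback_set (R d 1) by exists d.
have /choice[g gP] : forall k : subloop_loop pullback_subloop,
    exists d, R d 1 = sval k.
  by move=> k; have [d _ e] := svalP k; exists d.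
exists g; split; last first.
  move=> x y; apply: (@pullback_inj 1).
  by rewrite gP /= pullbackD -mul_pullback1 !gP.
exists (fun d => exist _ (R d 1) (Rset d) : subloop_loop pullback_subloop) => [k|d].
  by apply: (@subl_inj _ pullback_subloop); rewrite /= gP.
by apply: (@pullback_inj 1); rewrite gP.
Qed.

(** Cosets are the [R]-orbits, and [p] carries them onto shift orbits, that is, fibres over [F]. All
    three components of [T] qualify as [p]. *)
Lemma quotient_bijection (p : bijection Q E) :
  (forall d x, p (R d x) = shift (p x) d) ->
  exists q : bijection (quotient pullback_subloop) F,
    forall x, q (quot_class pullback_subloop x) = (p x).1.
Proof.
move=> pR; have /choice[r rP] := @quot_classP _ pullback_subloop.
have rE x : (p (r (quot_class pullback_subloop x))).1 = (p x).1.
  have /quot_class_eq[k [d _ <-] ->] := rP (quot_class pullback_subloop x).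
  by rewrite mul_pullback1 pR.
have [||q qE] := @bijection_of_inj_surj (quotient pullback_subloop) F
    (fun S => (p (r S)).1).
- move=> S S' /eq_fst_shift e; rewrite (rP S) (rP S'); apply/quot_class_eq.
  (* Two points of one fibre differ by the shift through the difference of their [A]-components. *)
  exists (R ((p (r S')).2 - (p (r S)).2)%R 1).
    by exists ((p (r S')).2 - (p (r S)).2)%R.
  by apply: (can_inj (bij_funK p)); rewrite mul_pullback1 pR.
- move=> y; exists (quot_class pullback_subloop (bij_inv p (y, 0%R))).
  by rewrite rE bij_invK.
by exists q => x; rewrite qE rE.
Qed.

Lemma pullback_isotopic : isotopic (quotient pullback_subloop) F.
Proof.
have [qa qaE] := quotient_bijection alpha_pullback.
have [qb qbE] := quotient_bijection beta_pullback.
have [qc qcE] := quotient_bijection gamma_pullback.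
constructor; apply: (@Isotopism _ _ qa qb qc) => S S'.
have [[x ->] [y ->]] := (quot_classP S, quot_classP S').
by rewrite /= quot_mulE qaE qbE qcE -isotopism_law.
Qed.

End PulledBackKernel.

(** * Normalization of cocycle identities *)

Section WeakEquivalence.
Variables (F : loop) (A : zmodType) (theta mu : cocycle F A).

Lemma normalizeD (m n : F -> F -> A) x y :
  normalize (fun x y => m x y + n x y)%R x y =
  (normalize m x y + normalize n x y)%R.
Proof.
rewrite /normalize !opprD [RHS]addrACA; congr (_ + _)%R.
by rewrite [RHS]addrACA; congr (_ + _)%R; rewrite [RHS]addrACA.
Qed.

Lemma normalize_fst (u : F -> A) x y :
  normalize (fun x _ => u x) x y = 0%R.
Proof. by rewrite /normalize subrr sub0r addNr. Qed.

Lemma normalize_snd (v : F -> A) x y :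
  normalize (fun _ y => v y) x y = 0%R.
Proof. by rewrite /normalize addrAC subrK subrr. Qed.

(* Normalization kills the terms depending on one variable and turns
   [w (x * y)] into the coboundary of [w - w 1]. *)
Lemma cocycle_equiv_of_weak_equiv (t : autotopism F) (h : {additive A -> A})
    (u v w : F -> A) :
  bijective h ->
  (forall x y, mu x y =
    h (theta (bij_inv (iso_alpha t) x) (bij_inv (iso_beta t) y))
    + w (x * y)%L - u x - v y)%R ->
  cocycle_equiv theta mu.
Proof.
move=> h_bij muE.
exists t, h, (normalized (fun x y => w (x * y))); split => //.
  exists (fun x => w x - w 1%L)%R; split=> [|x y]; first by rewrite subrr.
  rewrite /= /normalize mulx1 !mul1x !opprB.
  by rewrite !addrA subrK [RHS]addrAC.
move=> x y.
have -> : mu x y = normalize mu x y.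
  by rewrite /normalize cocyclex1 !cocycle1x !subr0 addr0.
rewrite /= -normalizeD.
set m := (X in _ = normalize X x y).
have -> : cocycle_fun mu = (fun x y => m x y - u x - v y)%R.
  by apply/funext => x'; apply/funext => y'; rewrite muE.
rewrite (normalizeD (fun x y => m x y - u x)%R (fun _ y => - v y)%R).
rewrite (normalizeD m (fun x _ => - u x)%R).
rewrite (normalize_fst (fun x => - u x)%R).
by rewrite (normalize_snd (fun y => - v y)%R) !addr0.
Qed.

End WeakEquivalence.

(** * Isotopisms that preserve the fibres over [F] *)

Section FibrePreserving.
Variables (F : loop) (A : zmodType) (theta mu : cocycle F A).
Variable T : isotopism (extension theta) (extension mu).
Hypothesis T_fibres :
  pullback_set T = [set x | x.1 = 1] :> set (extension theta).

Local Notation R := (pullback_translation T).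

(** The fibre over [1] has two parametrizations by [A], namely [e] to [(1, e)] and [d] to [R d 1];
    [h] is the change of parameter from the first to the second. *)
Lemma fibre_automorphism :
  exists h : {additive A -> A}, bijective h /\
    forall x e, R (h e) (x, 0%R) = (x, e).
Proof.
have /choice[h hP] : forall e, exists d, R d 1 = (1, e).
  move=> e; have : pullback_set T (1, e) by rewrite T_fibres.
  by case=> d _ <-; exists d.
have hD : {morph h : a b / (a + b)%R}.
  move=> a b; apply: (@pullback_inj _ _ _ _ T 1).
  rewrite pullbackD !hP -mul_pullback1 hP.
  by rewrite /= /ext_mul /= mulx1 cocyclex1 addr0.
have h0 : h 0%R = 0%R by apply: (addrI (h 0%R)); rewrite -hD !addr0.
pose hM := GRing.isNmodMorphism.Build A A h (conj h0 hD).
pose hA : {additive A -> A} := HB.pack h hM.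
exists hA; split; last first.
  move=> x e; rewrite -mul_pullback1 hP.
  by rewrite /= /ext_mul /= mulx1 cocyclex1 add0r addr0.
exists (fun d => (R d 1).2) => [e|d] /=; first by rewrite hP.
apply: (@pullback_inj _ _ _ _ T 1); rewrite hP.
have : pullback_set T (R d 1) by exists d.
by rewrite T_fibres /=; case: (R d 1) => x e /= ->.
Qed.

Lemma pullback_fst d x : (R d x).1 = x.1.
Proof.
rewrite -mul_pullback1 /=.
have : pullback_set T (R d 1) by exists d.
by rewrite T_fibres /= => ->; rewrite mulx1.
Qed.

(** Each [(x, e)] is the translate of [(x, 0)] by [R (h e)], so [p] is determined by its values on
    the section [(x, 0)], whose components are [q x] and [u x]. *)
Lemma base_bijection (h : A -> A)
    (p : bijection (extension theta) (extension mu)) :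
  (forall x e, R (h e) (x, 0%R) = (x, e)) ->
  (forall d x, p (R d x) = shift (p x) d) ->
  exists (q : bijection F F) (u : F -> A),
    forall x e, p (x, e) = (q x, (u x + h e)%R).
Proof.
move=> hP pR.
have pE x e : p (x, e) = shift (p (x, 0%R)) (h e) by rewrite -pR hP.
have qK : cancel (fun x => (p (x, 0%R)).1) (fun y => (bij_inv p (y, 0%R)).1).
  move=> x; set y := (p (x, 0%R)).1.
  (* Shifting [p (x, 0)] by minus its [A]-component gives [(y, 0)]. *)
  have -> : bij_inv p (y, 0%R) = R (- (p (x, 0%R)).2)%R (x, 0%R).
    apply: (can_inj (bij_funK p)).
    by rewrite bij_invK pR /shift subrr.
  by rewrite pullback_fst.
have qK' : cancel (fun y => (bij_inv p (y, 0%R)).1) (fun x => (p (x, 0%R)).1).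
  move=> y; case E : (bij_inv p (y, 0%R)) => [x e] /=.
  have := bij_invK p (y, 0%R).
  by rewrite E pE => /(congr1 fst).
exists (Bijection qK qK'), (fun x => (p (x, 0%R)).2) => x e.
by rewrite pE.
Qed.

Lemma fibre_preserving_cocycle_equiv : cocycle_equiv theta mu.
Proof.
have [h [h_bij hP]] := fibre_automorphism.
have [qa [u aE]] := base_bijection hP (alpha_pullback T).
have [qb [v bE]] := base_bijection hP (beta_pullback T).
have [qc [w cE]] := base_bijection hP (gamma_pullback T).
(* On the section [(x, 0)], the first components give an autotopism of [F] and the second ones the
   relation between [theta] and [mu]. *)
have law x y : (qa x * qb y, (u x + v y + mu (qa x) (qb y))%R) =
               (qc (x * y), (w (x * y)%L + h (theta x y))%R).
  have := isotopism_law T (x, 0%R) (y, 0%R).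
  by rewrite aE bE /= /ext_mul /= cE !raddf0 !addr0 add0r.
have tM x y : qa x * qb y = qc (x * y) by case: (law x y).
apply: (@cocycle_equiv_of_weak_equiv _ _ theta mu (Isotopism tM) h
  (u \o bij_inv qa) (v \o bij_inv qb) (w \o bij_inv qc)) => // x y /=.
have [_] := law (bij_inv qa x) (bij_inv qb y).
rewrite !bij_invK => e.
have -> : bij_inv qc (x * y) = bij_inv qa x * bij_inv qb y.
  by apply: (can_inj (bij_funK qc)); rewrite -tM !bij_invK.
by rewrite [(h _ + _)%R]addrC -e -addrA -opprD addrC addKr.
Qed.

End FibrePreserving.

(** * Alignment of the two kernels by transitivity *)

Theorem theorem4p1 (F : loop) (A : zmodType) (theta : cocycle F A) :
  aut_transitive
    [set K : central_subloop (extension theta) |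
       isomorphic (subloop_loop K) (zmod_loop A) /\ isotopic (quotient K) F] ->
  isotopy_separable theta.
Proof.
move=> trans mu [T].
pose I := isotopism_id (extension theta).
have [f [[[g fK gK] fM] fI]] := trans (pullback_subloop I) (pullback_subloop T)
  (conj (pullback_isomorphic I) (pullback_isotopic I))
  (conj (pullback_isomorphic T) (pullback_isotopic T)).
pose S := @isotopism_comp _ _ _ T (Bijection fK gK) fM.
have f1 : f 1 = 1 by apply: (@mul_injl _ (f 1)); rewrite -fM !mulx1.
(* Since [S] is [T] precomposed with [f], the map [f] intertwines the two translations. *)
have fS d : f (pullback_translation S d 1) = pullback_translation T d 1.
  by rewrite /pullback_translation /= f1 gK.
have IE : pullback_set I = [set x | x.1 = 1] :> set (extension theta).
  apply/seteqP; split=> [_ [d _ <-] //|[x a] /= ->].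
  by exists a; rewrite // /pullback_translation /shift /= add0r.
(* The kernels of [S] and [I] agree because the injective [f] maps each of them onto the kernel of
   [T]. *)
apply: (@fibre_preserving_cocycle_equiv _ _ _ _ S); rewrite -IE.
apply/seteqP; split=> x.
  move=> [d _ <-]; have : pullback_set T (f (pullback_translation S d 1)).
    by rewrite fS; exists d.
  by rewrite -[pullback_set T]fI => -[y Iy /(can_inj fK) <-].
move=> Ix; have : pullback_set T (f x) by rewrite -[pullback_set T]fI; exists x.
by case=> d _; rewrite -fS => /(can_inj fK) <-; exists d.
Qed.
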